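(* Let $0<k_1<\cdots<k_m<n$ be integers, $a_1,\dots,a_m$ positive integers, $\mathbf k=(k_1,\dots,k_m)$, $\mathbf l=(n-k_m,\dots,n-k_1)$, $\mathbf a=(a_1,\dots,a_m)$, $\mathbf b=(a_m,\dots,a_1)$, and for $N\ge0$ let $R_{\mathbf k}^{(N)}=\Gamma(F_{\mathbf k}(\mathbb C^n),\mathcal L_{\mathbf k}^{N\mathbf a})$ and $R_{\mathbf l}^{(N)}=\Gamma(F_{\mathbf l}(\mathbb C^n),\mathcal L_{\mathbf l}^{N\mathbf b})$. Then the $N$-th graded component $\widetilde\Psi:R_{\mathbf k}^{(N)}\to R_{\mathbf l}^{(N)}$ of the isomorphism $\widetilde\Psi$ is diagonal relative to the standard bases of $R_{\mathbf k}^{(N)}$ and $R_{\mathbf l}^{(N)}$ (it maps each standard basis vector to a scalar multiple of a standard basis vector). Moreover, for every semistandard tableau $T$ indexing a standard basis vector $f_T$ of $R_{\mathbf k}^{(N)}$, $$\widetilde\Psi(f_T)=\epsilon_T\,f_{\ast T}.$$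
   Context: $F_{\mathbf k}(\mathbb C^n)$ is the manifold of flags $V_1\subset\cdots\subset V_m\subset\mathbb C^n$, $\dim V_i=k_i$; $\mathcal L_{\mathbf k}^{N\mathbf a}$ is the line bundle with fibre $\bigotimes_i(\bigwedge^{k_i}V_i^* )^{\otimes Na_i}$. Map $\widetilde\Psi$: $B$ is the symmetric complex bilinear form on $\mathbb C^n$ with orthonormal standard basis; $\Psi(V_1\subset\cdots\subset V_m)=(V_m^\perp\subset\cdots\subset V_1^\perp)$. Let $\theta_1,\dots,\theta_n$ be the dual of the standard basis, $\theta_I=\theta_{i_1}\wedge\cdots\wedge\theta_{i_k}$ for $I=\{i_1<\cdots<i_k\}$, and $\ast\theta_I=\mathrm{sgn}(I,J)\theta_J$ the complex Hodge star ($J$ the complement of $I$ in $\{1,\dots,n\}$, $\mathrm{sgn}(I,J)$ the sign of the permutation listing $I$ then $J$ increasingly). For a $k$-dimensional subspace $x$ there is a well-defined isomorphism $\bigwedge^k(x^* )\to\bigwedge^{n-k}((x^\perp)^* )$, $\mathrm{res}_x(\tau)\mapsto\mathrm{res}_{x^\perp}(\ast\tau)$. $\hat\Psi:\mathcal L_{\mathbf k}^{N\mathbf a}\to\mathcal L_{\mathbf l}^{N\mathbf b}$ is the tensor product of these isomorphisms for $x=V_1,\dots,V_m$, followed by reversal of tensor factors, and $\widetilde\Psi(s)(x)=\hat\Psi(s(\Psi^{-1}(x)))$. Standard basis: let $D$ be the Young diagram whose $i$-th row has length equal to the $i$-th component of $N\sum_i a_i\varpi_{k_i}$, where $\varpi_k=(1,\dots,1,0,\dots,0)$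 with $k$ ones; so $D$ has $Na_i$ columns of length $k_i$ for each $i$. A filling of $D$ by integers in $\{1,\dots,n\}$ is semistandard if entries strictly increase down columns and weakly increase along rows. For such $T$, $f_T$ is the section whose value at $(V_1,\dots,V_m)$ is the product (tensor product in the fibre) over the columns $c$ of $T$ of $\mathrm{res}_{V_i}(\theta_{I_c})$, where $I_c$ is the set of entries of $c$ and $k_i$ its length. The $f_T$, $T$ semistandard, form a basis of $R_{\mathbf k}^{(N)}$, called the standard basis; similarly for $R_{\mathbf l}^{(N)}$ with $\mathbf l,\mathbf b$. Dual tableau and sign: extend $T$ to a filling $\widetilde T$ of the rectangle with $n$ rows and the same number of columns, by writing below each column of $T$ the complementary elements of $\{1,\dots,n\}$ in increasing order. $\ast T$ is the tableau formed by the added columns written in reverse (right-to-left) order. $\epsilon_T$ is the product over all columns of $\widetilde T$ of the sign of the permutation of $\{1,\dots,n\}$ obtained by reading that column from top to bottom. *)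

(* Defs.v *)
From HB Require Import structures.
From mathcomp Require Import all_boot all_order all_algebra all_fingroup complex.
From mathcomp Require Import boolp classical_sets functions reals topology.
From mathcomp Require Import normedtype derive.

Set Implicit Arguments.
Unset Strict Implicit.
Unset Printing Implicit Defensive.

Import Order.TTheory GRing.Theory Num.Theory numFieldNormedType.Exports.
Local Open Scope ring_scope.

(* Indices are 0-based: the flag V_1 < ... < V_m and the vectors k, a are      *)
(* indexed by 'I_m, the standard basis of C^n and the entries of tableaux by   *)
(* 'I_n.  C^n is the space of row vectors.                                     *)

Section Flags.
Variables (R : realType) (n m : nat).
Notation C := (complex R).
Implicit Types k : 'I_m -> nat.

Definition is_flag k (x : {ffun 'I_m -> {vspace 'rV[C]_n}}) : bool :=
  [forall i : 'I_m, \dim (x i) == k i] &&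
  [forall i : 'I_m, forall j : 'I_m, (i <= j)%N ==> (x i <= x j)%VS].

Record flag k := Flag {
  flag_val :> {ffun 'I_m -> {vspace 'rV[C]_n}};
  flagP : is_flag k flag_val }.

HB.instance Definition _ k := [isSub for @flag_val k].

Definition bilin (u v : 'rV[C]_n) : C := \sum_i u 0 i * v 0 i.

Definition basis_mx (V : {vspace 'rV[C]_n}) : 'M[C]_(\dim V, n) :=
  \matrix_i (vbasis V)`_i.

(* u |-> (B(u, v))_v for v in a basis of V; its kernel is V^perp (perpP) *)
Definition pairing (V : {vspace 'rV[C]_n}) : 'Hom('rV[C]_n, 'rV[C]_(\dim V)) :=
  linfun (mulmxr (basis_mx V)^T).

Definition perp (V : {vspace 'rV[C]_n}) : {vspace 'rV[C]_n} := lker (pairing V).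

Lemma bilinC u v : bilin u v = bilin v u.
Proof. by apply: eq_bigr => i _; rewrite mulrC. Qed.

Lemma bilin_mx u v : u *m v^T = (bilin u v)%:M :> 'M[C]_1.
Proof.
apply/matrixP=> i j; rewrite !ord1 !mxE eqxx mulr1n.
by apply: eq_bigr => s _; rewrite !mxE.
Qed.

Lemma bilin_sumr (I : Type) (r : seq I) (c : I -> C) (F : I -> 'rV[C]_n) u :
  bilin u (\sum_(i <- r) c i *: F i) = \sum_(i <- r) c i * bilin u (F i).
Proof.
rewrite /bilin; under eq_bigr => s _ do rewrite summxE mulr_sumr.
rewrite exchange_big /=; apply: eq_bigr => i _; rewrite mulr_sumr.
by apply: eq_bigr => s _; rewrite mxE mulrCA.
Qed.

Lemma perpP (V : {vspace 'rV[C]_n}) (u : 'rV[C]_n) :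
  reflect (forall v, v \in V -> bilin u v = 0) (u \in perp V).
Proof.
have pE : pairing V u = \row_i bilin u (vbasis V)`_i.
  rewrite lfunE /=; apply/rowP => i; rewrite !mxE.
  by apply: eq_bigr => s _; rewrite !mxE.
rewrite memv_ker pE; apply: (iffP eqP) => [/rowP z v Vv | uV].
  rewrite (coord_vbasis Vv) bilin_sumr big1 // => i _.
  by move: (z i); rewrite !mxE => ->; rewrite mulr0.
apply/rowP => i; rewrite !mxE uV //.
by apply: vbasis_mem; rewrite mem_nth // size_tuple.
Qed.

Lemma perp_sub (U V : {vspace 'rV[C]_n}) : (U <= V)%VS -> (perp V <= perp U)%VS.
Proof.
move/subvP => UV; apply/subvP => u /perpP uV; apply/perpP => v Uv.
exact/uV/UV.
Qed.

Lemma row_free_basis V : row_free (basis_mx V).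
Proof.
rewrite -kermx_eq0; apply/rowV0P => c /sub_kermxP cM.
have /freeP fr := basis_free (vbasisP V).
apply/rowP => i; rewrite mxE; apply: (fr (fun i => c 0 i)).
transitivity (c *m basis_mx V); last exact: cM.
rewrite mulmx_sum_row; apply: eq_bigr => j _; congr (_ *: _).
by apply/rowP => s; rewrite !mxE.
Qed.

Lemma dim_perp V : \dim (perp V) = (n - \dim V)%N.
Proof.
have full_img : limg (pairing V) = fullv.
  apply/eqP; rewrite eqEsubv subvf /=; apply/subvP => w _.
  have fullT : row_full (basis_mx V)^T.
    by rewrite /row_full mxrank_tr; exact: row_free_basis.
  apply/memv_imgP; exists (w *m pinvmx (basis_mx V)^T); first exact: memvf.
  by rewrite lfunE /= mulmxKpV // submx_full.
have := limg_ker_dim (pairing V) fullv.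
rewrite capfv full_img !dimvf /dim /= !mul1n => eq_n.
by have := congr1 (subn^~ (\dim V)) eq_n; rewrite addnK.
Qed.

Lemma perpK V : perp (perp V) = V.
Proof.
apply/eqP; rewrite eq_sym eqEdim !dim_perp; apply/andP; split.
  by apply/subvP => v Vv; apply/perpP => u /perpP/(_ v Vv); rewrite bilinC.
rewrite subKn //; have := dim_perp V; have := dimvS (subvf V).
by rewrite dimvf /dim /= mul1n.
Qed.

(* l = (n - k_m, ..., n - k_1) and b = (a_m, ..., a_1) *)
Definition dual_dims k : 'I_m -> nat := fun i => (n - k (rev_ord i))%N.
Definition dual_mults (a : 'I_m -> nat) : 'I_m -> nat := fun i => a (rev_ord i).

Definition perp_flag (x : {ffun 'I_m -> {vspace 'rV[C]_n}}) :
    {ffun 'I_m -> {vspace 'rV[C]_n}} := [ffun i => perp (x (rev_ord i))].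

Lemma perp_flagP k x : is_flag k x -> is_flag (dual_dims k) (perp_flag x).
Proof.
case/andP=> /forallP dx /forallP sx; apply/andP; split.
  by apply/forallP => i; rewrite ffunE dim_perp (eqP (dx _)).
apply/forallP => i; apply/forallP => j; apply/implyP => ij; rewrite !ffunE.
apply: perp_sub; have /forallP/(_ (rev_ord i))/implyP := sx (rev_ord j).
by apply; rewrite /= leq_sub2l.
Qed.

Definition Psi k (x : flag k) : flag (dual_dims k) := Flag (perp_flagP (flagP x)).

Lemma perp_flag_invP k (hk : forall i, (0 < k i < n)%N) y :
  is_flag (dual_dims k) y -> is_flag k (perp_flag y).
Proof.
move/perp_flagP => /andP[/forallP dx sx]; apply/andP; split=> //.
apply/forallP => i; rewrite (eqP (dx i)) /dual_dims rev_ordK subKn //.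
by case/andP: (hk i) => _ /ltnW.
Qed.

Definition Psi_inv k (hk : forall i, (0 < k i < n)%N)
  (y : flag (dual_dims k)) : flag k := Flag (perp_flag_invP hk (flagP y)).

Lemma perp_flagK : involutive perp_flag.
Proof. by move=> x; apply/ffunP => i; rewrite !ffunE rev_ordK perpK. Qed.

Lemma PsiK k (hk : forall i, (0 < k i < n)%N) : cancel (@Psi k) (Psi_inv hk).
Proof. by move=> x; apply: val_inj; exact: perp_flagK. Qed.

Lemma Psi_invK k (hk : forall i, (0 < k i < n)%N) : cancel (Psi_inv hk) (@Psi k).
Proof. by move=> x; apply: val_inj; exact: perp_flagK. Qed.

End Flags.

Section ExteriorAlgebra.
Variables (R : realType) (n : nat).
Notation C := (complex R).

(* sign of the permutation of {0, ..., n-1} listed by w (+1 if w is not one) *)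
Definition word_sign (w : seq 'I_n) : C :=
  (-1) ^+ odd_perm (insubd (1%g : 'S_n) [ffun r : 'I_n => nth r w r]).

Definition sgn_sets (I J : {set 'I_n}) : C := word_sign (enum I ++ enum J).

(* the exterior algebra of (C^n)^*, in coordinates on the basis (theta_I)_I *)
Definition ext := {ffun {set 'I_n} -> C}.

Definition theta (I : {set 'I_n}) : ext := [ffun J => (J == I)%:R].

Definition hodge (tau : ext) : ext :=
  [ffun J => sgn_sets (~: J) J * tau (~: J)].

Lemma hodge_theta I : hodge (theta I) =
    [ffun J => sgn_sets I (~: I) * theta (~: I) J].
Proof.
apply/ffunP => J; rewrite !ffunE (can2_eq (@finset.setCK _) (@finset.setCK _)).
by case: eqP => [-> | _]; rewrite ?mulr0 // finset.setCK.
Qed.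

(* theta_I (v_1, ..., v_k) = det (v_r)_i, i in I, the v_r being the rows of A; *)
(* meant for #|I| = k, the only case in which conform_mx returns the submatrix *)
Definition theta_eval k (I : {set 'I_n}) (A : 'M[C]_(k, n)) : C :=
  \det (conform_mx (0 : 'M[C]_k) (colsub (@enum_val _ (mem I)) A)).

Definition ext_eval k (tau : ext) (A : 'M[C]_(k, n)) : C :=
  \sum_(I : {set 'I_n} | #|I| == k) tau I * theta_eval I A.

(* res_V : Lambda^k (C^n)^* -> Lambda^k V^*, applied to the degree k part of tau *)
Definition res (V : {vspace 'rV[C]_n}) k (tau : ext)
    (v : 'I_k -> subvs_of V) : C :=
  ext_eval tau (\matrix_r vsval (v r)).

(* f is an element of Lambda^k V^* *)
Definition alternating_form (V : {vspace 'rV[C]_n}) k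
    (f : ('I_k -> subvs_of V) -> C) : Prop :=
  (forall v r c u u', f [eta v with r |-> c *: u + u'] =
     c * f [eta v with r |-> u] + f [eta v with r |-> u']) /\
  (forall v r r', r != r' -> v r = v r' -> f v = 0).

End ExteriorAlgebra.

Section LineBundle.
Variables (R : realType) (n m : nat) (k a : 'I_m -> nat) (N : nat).
Notation C := (complex R).

(* the tensor factors of the fibre: N a_i copies of Lambda^{k_i} V_i^* for each i *)
Definition tfactor := {i : 'I_m & 'I_(N * a i)}.

Definition frames (x : flag R n k) :=
  forall p : tfactor, 'I_(k (tag p)) -> subvs_of (x (tag p)).

(* An element of \bigotimes_p Lambda^{k_p} V_p^* is a function of one k_p-tuple *)
(* of vectors of V_p for each factor p which is, in each of these tuples       *)
(* separately, multilinear and alternating.                                    *)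
Definition fibre_fun (x : flag R n k) := frames x -> C^o.

Definition in_fibre (x : flag R n k) (phi : fibre_fun x) : Prop :=
  forall (p : tfactor) (v : frames x),
    alternating_form (fun u : 'I_(k (tag p)) -> subvs_of (x (tag p)) =>
      phi (@eqtype.dfwith _ _ v p u)).

Definition tensor_res (x : flag R n k) (tau : tfactor -> ext R n) : fibre_fun x :=
  fun v => \prod_(p : tfactor) res (tau p) (v p).

Definition section := forall x : flag R n k, fibre_fun x.

Definition section_zero : section := fun=> 0.
Definition section_opp (s : section) : section := fun x => - s x.
Definition section_add (s t : section) : section := fun x => s x + t x.
Definition section_scale (c : C) (s : section) : section := fun x => c *: s x.

Lemma section_addA : associative section_add.
Proof. by move=> s t u; apply/functional_extensionality_dep => x; exact: addrA. Qed.

Lemma section_addC : commutative section_add.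
Proof. by move=> s t; apply/functional_extensionality_dep => x; exact: addrC. Qed.

Lemma section_add0 : left_id section_zero section_add.
Proof. by move=> s; apply/functional_extensionality_dep => x; exact: add0r. Qed.

Lemma section_addN : left_inverse section_zero section_opp section_add.
Proof. by move=> s; apply/functional_extensionality_dep => x; exact: addNr. Qed.

HB.instance Definition _ := gen_eqMixin section.
HB.instance Definition _ := gen_choiceMixin section.
HB.instance Definition _ := GRing.isZmodule.Build section
  section_addA section_addC section_add0 section_addN.

Lemma section_scaleA c d s :
  section_scale c (section_scale d s) = section_scale (c * d) s.
Proof. by apply/functional_extensionality_dep => x; exact: scalerA. Qed.

Lemma section_scale1 : left_id 1 section_scale.
Proof. by move=> s; apply/functional_extensionality_dep => x; exact: scale1r. Qed.

Lemma section_scaleDr : right_distributive section_scale +%R.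
Proof. by move=> c s t; apply/functional_extensionality_dep => x; exact: scalerDr. Qed.

Lemma section_scaleDl s : {morph section_scale^~ s : c d / c + d}.
Proof. by move=> c d; apply/functional_extensionality_dep => x; exact: scalerDl. Qed.

HB.instance Definition _ := GRing.Zmodule_isLmodule.Build C section
  section_scaleA section_scale1 section_scaleDr section_scaleDl.

(* Holomorphic charts: for g invertible, Z |-> the flag spanned by the leading *)
(* rows of chart_mx Z *m g.  Only the block strictly upper triangular part of  *)
(* Z is used; it gives affine coordinates on an open cell around the flag of g *)
(* and these rows form a holomorphic frame of the tautological subbundles.     *)
Definition chart_mx (Z : 'M[C]_n) : 'M[C]_n :=
  \matrix_(r, s) ((r == s)%:R +
    (if [exists i, (r < k i <= s)%N] then Z r s else 0)).

Definition rows (h : 'M[C]_n) : seq 'rV[C]_n := [seq row r h | r <- enum 'I_n].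

Definition span_flag (h : 'M[C]_n) : {ffun 'I_m -> {vspace 'rV[C]_n}} :=
  [ffun i => <<take (k i) (rows h)>>%VS].

Definition row_frames (x : flag R n k) (h : 'M[C]_n) : frames x :=
  fun p r => vsproj (x (tag p)) (rows h)`_r.

(* The coefficient of s in the local trivialisation over the chart at g; for k *)
(* increasing with 0 < k_i < n and g invertible, insub always succeeds.        *)
Definition chart_coef (s : section) (g : 'M[C]_n) (Z : 'M[C]_n) : C^o :=
  let h := chart_mx Z *m g in
  if insub (span_flag h) is Some x then s x (row_frames x h) else 0.

(* R_k^(N), the holomorphic sections *)
Definition holomorphic_section (s : section) : Prop :=
  (forall x, in_fibre (s x)) /\
  (forall g : 'M[C]_n, g \in unitmx ->
     forall Z, differentiable (chart_coef s g) Z).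

(* A filling of D is a family of columns, one of length k_i for each factor    *)
(* p = (i, j), listing its entries from top to bottom.                         *)
Definition filling := forall p : tfactor, 'I_(k (tag p)) -> 'I_n.

(* the column p of D lies to the left of the column q: longer columns come first *)
Definition left_of (p q : tfactor) : bool :=
  (tag q < tag p)%N || ((tag p == tag q) && (tagged p < tagged q)%N).

Definition semistandard (T : filling) : Prop :=
  (forall p (r s : 'I_(k (tag p))), (r < s)%N -> (T p r < T p s)%N) /\
  (forall p q (r : 'I_(k (tag p))) (s : 'I_(k (tag q))),
     left_of p q -> r = s :> nat -> (T p r <= T q s)%N).

Definition col_set (T : filling) (p : tfactor) : {set 'I_n} :=
  [set T p r | r : 'I_(k (tag p))].

Definition standard_section (T : filling) : section :=
  fun x => @tensor_res x (fun p => theta R (col_set T p)).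

Definition standard_vector (s : section) : Prop :=
  exists2 T, semistandard T & s = standard_section T.

(* reading of the column p of the extended filling of the n-row rectangle *)
Definition ext_column (T : filling) (p : tfactor) : seq 'I_n :=
  [seq T p r | r <- enum 'I_(k (tag p))] ++ enum (~: col_set T p).

Definition epsilon (T : filling) : C :=
  \prod_(p : tfactor) word_sign R (ext_column T p).

End LineBundle.

Arguments tensor_res {R n m k a N} x tau _.
Arguments standard_section {R n m k a N} T x _.

Section Duality.
Variables (R : realType) (n m : nat) (k a : 'I_m -> nat) (N : nat).
Notation C := (complex R).
Notation l := (dual_dims n k).
Notation b := (dual_mults a).

Definition rev_factor (q : tfactor b N) : tfactor a N :=
  Tagged (fun i => 'I_(N * a i)) (rev_ord (tagged q)).

(* The default value of nth is not used when T is semistandard. *)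
Definition dual_filling (T : filling n k a N) : filling n l b N :=
  fun q r => nth (widen_ord (leq_subr _ _) r) (enum (~: col_set T (rev_factor q))) r.

(* The graph of Psi-hat : L_x -> L_y, where y = Psi x: the linear map sending  *)
(* each \bigotimes_p res (tau_p) to the reversal of \bigotimes_p res (hodge tau_p). *)
Definition Psi_hat_graph (x : flag R n k) (y : flag R n l)
    (phi : fibre_fun a N x) (psi : fibre_fun b N y) : Prop :=
  exists t : seq (C * (tfactor a N -> ext R n)),
    phi = \sum_(d <- t) d.1 *: tensor_res x d.2 /\
    psi = \sum_(d <- t) d.1 *: tensor_res y (fun q => hodge (d.2 (rev_factor q))).

Definition Psi_hat (x : flag R n k) (y : flag R n l)
    (phi : fibre_fun a N x) : fibre_fun b N y :=
  xget 0 [set psi | Psi_hat_graph phi psi]%classic.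

Arguments Psi_hat : clear implicits.

Definition Psi_tilde (hk : forall i, (0 < k i < n)%N)
    (s : section R n k a N) : section R n l b N :=
  fun y => Psi_hat (Psi_inv hk y) y (s (Psi_inv hk y)).

End Duality.

Arguments Psi_hat {R n m k a N} x y phi.
Arguments Psi_tilde {R n m k a N} hk s.

(* Main.v *)
(* An invertible matrix h gives a frame of the flag x spanned by its leading rows, *)
(* and the rows of h^{-T} in reverse order give a frame h* of the flag Psi(x).     *)
(* By Jacobi's identity for complementary minors, the Hodge star multiplies the    *)
(* value on the frame by a nonzero constant depending only on det h.  As an        *)
(* element of a fibre is determined by its value on one frame, Psi-hat is thereby  *)
(* a well-defined linear isomorphism.  It preserves holomorphy because h |-> h*    *)
(* carries the chart at g to the chart at g* by a polynomial change of coordinates *)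
(* (a block unipotent matrix is sent to its inverse transpose) and det h is        *)
(* constant on a chart.  The formula on tableaux is *theta_I = sgn(I, ~I)          *)
(* theta_{~I}, taken column by column, and the dual tableau is semistandard since  *)
(* complementation reverses the counting order on sets of entries.                 *)

Require Import Defs.
From HB Require Import structures.
From mathcomp Require Import all_boot all_order all_algebra complex.
From mathcomp Require Import boolp classical_sets functions reals topology.
From mathcomp Require Import normedtype derive.
From mathcomp Require Import all_fingroup zify ring.

Set Implicit Arguments.
Unset Strict Implicit.
Unset Printing Implicit Defensive.

Import Order.TTheory GRing.Theory Num.Theory numFieldNormedType.Exports.
Local Open Scope ring_scope.

(** * Alternating forms *)

(** Each fibre of the line bundle is a line: an element vanishing on one frame vanishes
    ([fibre_eq0]), and every element is a multiple of a pure tensor ([in_fibre_tensor_resP]).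
    Statements about fibres and sections thus reduce to scalars read on frames. An invertible [h]
    gives a frame of a flag, and [dual_frame h], the dual basis in reverse order, gives a frame of
    the orthogonal flag ([span_flag_dual]). Jacobi's identity ([complementary_minor]) shows that the
    Hodge star multiplies values on these two frames by a nonzero scalar that depends on [h] only
    through its determinant ([ext_eval_hodge], [tensor_res_hodge]). Hence [Psi_hat] is well defined
    and is multiplication by [frame_const h] in these trivialisations, which gives linearity and
    bijectivity.

    Chart matrices have determinant 1, so this scalar is constant on a chart, and dualising carries
    charts to charts by a polynomial change of coordinates ([dual_frame_chart]).
    [holomorphic_transfer] draws holomorphy from this in both directions.

    On tableaux the star acts column by column, each column giving its complement and a sign;
    [epsilonE] identifies the product of the signs. Semistandardness of the dual
    ([dual_filling_semistandard]) comes from comparing columns by their numbers of entries below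
    each [j], a comparison that complementation reverses. *)

Section AlternatingForms.
Variables (R : realType) (n : nat) (V : {vspace 'rV[complex R]_n}) (k : nat).
Variable f : ('I_k -> subvs_of V) -> complex R.
Hypothesis alt_f : alternating_form f.
Implicit Types (v e : 'I_k -> subvs_of V) (u : subvs_of V).

Lemma with_id v r : [eta v with r |-> v r] = v :> ('I_k -> subvs_of V).
Proof. by apply/funext => s /=; case: eqP => [->|]. Qed.

Lemma alternating_with0 v r : f [eta v with r |-> 0] = 0.
Proof.
have [lin _] := alt_f.
by have := lin v r (-1) 0 0; rewrite scaler0 addr0 mulN1r addNr.
Qed.

Lemma alternatingD v r u u' :
  f [eta v with r |-> u + u'] = f [eta v with r |-> u] + f [eta v with r |-> u'].
Proof. by have [lin _] := alt_f; rewrite -[u]scale1r lin mul1r scale1r. Qed.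

Lemma alternating_lincomb v r (I : Type) (s : seq I) (c : I -> complex R)
    (F : I -> subvs_of V) :
  f [eta v with r |-> \sum_(i <- s) c i *: F i] =
  \sum_(i <- s) c i * f [eta v with r |-> F i].
Proof.
have [lin _] := alt_f.
elim: s => [|i s IH]; first by rewrite !big_nil alternating_with0.
by rewrite !big_cons lin IH.
Qed.

(** Polarisation: expand the zero value of [f] at the tuple carrying [v r + v r'] in both slots. *)
Lemma alternating_tperm v r r' : r != r' -> f (v \o tperm r r') = - f v.
Proof.
move=> rr'; have [_ alt] := alt_f.
pose w a b : 'I_k -> subvs_of V := [eta [eta v with r |-> a] with r' |-> b].
have wC a b : w a b = [eta [eta v with r' |-> b] with r |-> a].
  apply/funext => s; rewrite /w /=; have [->|//] := eqVneq s r'.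
  by rewrite eq_sym (negPf rr').
have w0 a : f (w a a) = 0 by apply: (alt _ r r' rr'); rewrite /w /= (negPf rr') !eqxx.
have wDl a a' b : f (w (a + a') b) = f (w a b) + f (w a' b).
  by rewrite !wC alternatingD.
have := w0 (v r + v r'); rewrite wDl /w !alternatingD -!/(w _ _) !w0 add0r addr0.
have -> : w (v r) (v r') = v by rewrite wC; apply/funext => s /=; do 2![case: eqP => [->|_] //].
have -> : w (v r') (v r) = v \o tperm r r'.
  apply/funext => s; rewrite /w /=; have [->|s'] := eqVneq s r'; first by rewrite tpermR.
  have [->|sr] := eqVneq s r; first by rewrite tpermL.
  by rewrite tpermD // eq_sym.
by rewrite addrC => /eqP; rewrite addr_eq0 => /eqP.
Qed.

Lemma alternating_perm_eq0 e (s : 'S_k) : f e = 0 -> f (e \o s) = 0.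
Proof.
move=> fe0; have [ts -> {s}] := prod_tpermP s.
elim: ts => [|[r r'] ts IH] /=.
  by rewrite big_nil (_ : e \o _ = e) //; apply/funext => i /=; rewrite perm1.
case/andP=> rr' /IH fts; rewrite big_cons /=.
set P := (\prod_(t <- ts) _)%g in fts *.
have -> : e \o (tperm r r' * P)%g = (e \o P) \o tperm r r'.
  by apply/funext => i /=; rewrite permM.
by rewrite alternating_tperm // fts oppr0.
Qed.

(** Expanding every slot over the family [e] leaves values [f (e \o g)]. If [g] is not injective
    these vanish by alternation; otherwise [g] is a permutation and the value is [f e] up to
    sign. *)
Lemma alternating_eq0 e :
  (forall u, exists c, u = \sum_i c i *: e i) -> f e = 0 -> forall v, f v = 0.
Proof.
move=> span_e fe0 v; have [_ alt] := alt_f.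
(* [l] lists the slots not yet known to hold a vector of [e]. *)
suff: forall (l : seq 'I_k) v,
    (forall r, r \notin l -> exists s, v r = e s) -> f v = 0.
  by move/(_ (enum 'I_k) v); apply => r; rewrite mem_enum.
move=> {v}; elim=> [|r l IH] v vl; last first.
  have [c vr] := span_e (v r).
  rewrite -(with_id v r) vr alternating_lincomb big1 // => i _.
  rewrite IH ?mulr0 // => s sl /=; case: eqP => [_|/eqP sr]; first by exists i.
  by apply: vl; rewrite inE negb_or sr.
have /fin_all_exists [g vg] : forall r, exists s, v r = e s by move=> r; exact: vl.
have [/injectiveP g_inj|/injectivePn [r [r' rr' grr']]] := boolP (injectiveb g).
  rewrite (_ : v = e \o perm g_inj); first exact: alternating_perm_eq0.
  by apply/funext => r /=; rewrite permE vg.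
by apply: (alt _ _ _ rr'); rewrite !vg grr'.
Qed.

End AlternatingForms.

(** The uniqueness half of the fibre being a line. Tensor factors are moved from [e] to [v] one at a
    time, each by [alternating_eq0]. *)
Lemma fibre_eq0 (R : realType) (n m : nat) (k a : 'I_m -> nat) (N : nat)
    (x : flag R n k) (phi : fibre_fun a N x) (e : frames a N x) :
  in_fibre phi -> (forall p u, exists c, u = \sum_i c i *: e p i) ->
  phi e = 0 -> phi = 0.
Proof.
move=> in_phi span_e phie0; apply/funext => v.
suff: forall (l : seq (tfactor a N)) v,
    (forall p, p \notin l -> v p = e p) -> phi v = 0.
  by move/(_ (index_enum _) v); apply => p; rewrite mem_index_enum.
move=> {v}; elim=> [|q l IH] v vl.
  by rewrite (_ : v = e) //; apply/functional_extensionality_dep => p; exact: vl.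
have -> : v = @eqtype.dfwith _ _ v q (v q).
  by apply/functional_extensionality_dep => p; case: eqtype.dfwithP.
apply: (@alternating_eq0 _ _ _ _ _ (in_phi q v) (e q)); first exact: span_e.
apply: IH => p pl; have [<-|qp] := eqVneq q p; first by rewrite eqtype.dfwith_in.
by rewrite eqtype.dfwith_out //; apply: vl; rewrite inE negb_or eq_sym qp.
Qed.

(** * Complementary minors *)

Section ComplementaryMinors.
Variable R : realType.
Local Notation C := (complex R).

Lemma word_sign_perm n (w : seq 'I_n) : uniq w -> size w = n ->
  exists2 s : 'S_n, forall (x0 : 'I_n) r, s r = nth x0 w r
    & word_sign R w = (-1) ^+ s.
Proof.
move=> w_uniq w_size; pose f := [ffun r : 'I_n => nth r w r].
have f_inj : injectiveb f.
  apply/injectiveP => r r'; rewrite !ffunE (@set_nth_default _ w r r') ?w_size //.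
  by move/eqP; rewrite nth_uniq ?w_size // => /eqP/val_inj.
exists (Perm f_inj); last by rewrite /word_sign /insubd insubT.
by move=> x0 r; rewrite -pvalE /= ffunE (@set_nth_default _ w x0 r) ?w_size //.
Qed.

Lemma theta_evalE n k (I : {set 'I_n}) (A : 'M[C]_(k, n)) x0 : #|I| = k ->
  theta_eval I A = \det (\matrix_(r < k, s < k) A r (nth x0 (enum I) s)).
Proof.
move=> Ik; case: k / Ik A => A; rewrite /theta_eval conform_mx_id.
by congr (\det _); apply/matrixP => r s; rewrite !mxE (enum_val_nth x0).
Qed.

Lemma sgn_sets_perm n (I : {set 'I_n}) :
  exists2 s : 'S_n, forall (x0 : 'I_n) r, s r = nth x0 (enum I ++ enum (~: I)) r
    & sgn_sets R I (~: I) = (-1) ^+ s.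
Proof.
apply: word_sign_perm.
  rewrite cat_uniq !enum_uniq /= andbT; apply/hasPn => i.
  by rewrite !mem_enum inE.
by rewrite size_cat -!cardE cardsC card_ord.
Qed.

Lemma complementary_minor k p (h : 'M[C]_(k + p)) (I : {set 'I_(k + p)}) x0 :
  h \in unitmx -> #|I| = k ->
  \det (\matrix_(r < p, s < p)
          (invmx h)^T (rshift k r) (nth x0 (enum (~: I)) s)) =
  sgn_sets R I (~: I) / \det h *
  \det (\matrix_(r < k, s < k) h (lshift p r) (nth x0 (enum I) s)).
Proof.
move=> h_unit cI; have [s sE ->] := sgn_sets_perm I.
have szI : size (enum I) = k by rewrite -cardE.
pose A := col_perm s h; pose B := col_perm s (invmx h)^T.
have AB : A *m B^T = 1%:M.
  rewrite /A /B !col_permE trmx_mul trmxK tr_perm_mx invgK mulmxA -(mulmxA h).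
  by rewrite -perm_mxM mulVg perm_mx1 mulmx1 mulmxV.
(* Jacobi's trick: the first k columns of X are those of the identity, the last *)
(* p are those of B^T = A^-1, so that A *m X is block lower triangular. *)
pose X : 'M_(k + p) := block_mx 1%:M (dlsubmx B)^T 0 (drsubmx B)^T.
have AX : A *m X = block_mx (ulsubmx A) 0 (dlsubmx A) 1%:M.
  move: AB; rewrite -{1 2}[A]submxK -{1}[B]submxK tr_block_mx !mulmx_block.
  rewrite (@scalar_mx_block _ k p 1) => /eq_block_mx [_ e1 _ e2].
  by rewrite !mulmx1 !mulmx0 !addr0 e1 e2.
have := congr1 determinant AX.
rewrite det_mulmx det_ublock det_lblock !det1 mul1r mulr1 det_tr.
have -> : \det A = (-1) ^+ s * \det h.
  by rewrite /A col_permE det_mulmx det_perm odd_permV mulrC.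
have -> : drsubmx B = \matrix_(r < p, s < p)
          (invmx h)^T (rshift k r) (nth x0 (enum (~: I)) s).
  apply/matrixP => i j; rewrite !mxE (sE x0) nth_cat szI /=.
  by rewrite ltnNge leq_addr /= addKn.
have -> : ulsubmx A = \matrix_(r < k, s < k) h (lshift p r) (nth x0 (enum I) s).
  by apply/matrixP => i j; rewrite !mxE (sE x0) nth_cat szI /= ltn_ord.
have dh : \det h != 0 by rewrite -unitfE -unitmxE.
move=> <-; set e := (-1) ^+ s; set b := \det _.
have ee : e * e = 1 by rewrite /e -expr2 sqrr_sign.
rewrite -[LHS]mul1r -[1]ee -[b in LHS]mul1r -(mulVf dh); ring.
Qed.

(* Row r is dual, under the bilinear form, to row n - 1 - r of h. *)
Definition dual_frame n (h : 'M[C]_n) : 'M[C]_n :=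
  \matrix_r row (rev_ord r) (invmx h)^T.

Definition lead_rows n k (h : 'M[C]_n) : 'M[C]_(k, n) := \matrix_r (rows h)`_r.

Lemma nth_rows n (h : 'M[C]_n) (r : 'I_n) : (rows h)`_r = row r h.
Proof. by rewrite (nth_map r) ?nth_ord_enum // size_enum_ord. Qed.

Lemma lead_rowsE n k (h : 'M[C]_n) (r : 'I_k) (r' : 'I_n) s :
  r = r' :> nat -> lead_rows k h r s = h r' s.
Proof. by move=> rr'; rewrite mxE rr' nth_rows mxE. Qed.

(** Sign of the order reversal, needed because [dual_frame] lists the rows of the inverse transpose
    backwards. *)
Definition reversal_sign p : C := (-1) ^+ odd_perm (perm (@rev_ord_inj p)).

(** The sign in the Hodge star cancels that of Jacobi's identity; only the reversal of the rows and
    the determinant remain. *)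
Lemma theta_eval_dual_frame n k p (x0 : 'I_n) (h : 'M[C]_n) (I : {set 'I_n}) :
  (k + p)%N = n -> h \in unitmx -> #|I| = k ->
  sgn_sets R I (~: I) * theta_eval (~: I) (lead_rows p (dual_frame h)) =
  reversal_sign p / \det h * theta_eval I (lead_rows k h).
Proof.
move=> kpn; case: n / kpn x0 h I => x0 h I h_unit cI.
have cIC : #|~: I| = p by have := cardsC I; rewrite cI card_ord => /addnI.
rewrite (theta_evalE _ x0 cI) (theta_evalE _ x0 cIC).
have -> : \matrix_(r < p, s < p) lead_rows p (dual_frame h) r (nth x0 (enum (~: I)) s)
    = row_perm (perm (@rev_ord_inj p)) (\matrix_(r < p, s < p)
          (invmx h)^T (rshift k r) (nth x0 (enum (~: I)) s)).
  apply/matrixP => r s; rewrite mxE [in RHS]mxE [RHS]mxE permE.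
  rewrite (@lead_rowsE _ _ _ r (widen_ord (leq_addl k p) r)) // mxE mxE.
  by congr (_ _ _); apply: val_inj; rewrite /= addnBA.
have -> : \matrix_(r < k, s < k) lead_rows k h r (nth x0 (enum I) s) =
    \matrix_(r < k, s < k) h (lshift p r) (nth x0 (enum I) s).
  by apply/matrixP => r s; rewrite mxE [RHS]mxE (@lead_rowsE _ _ _ r (lshift p r)).
rewrite row_permE det_mulmx det_perm (complementary_minor _ h_unit cI) /reversal_sign.
have [s _ ->] := sgn_sets_perm I.
have ee : (-1) ^+ s * (-1) ^+ s = 1 :> C by rewrite -expr2 sqrr_sign.
have cancel (c d b e : C) : e * e = 1 -> e * (c * (e * d * b)) = c * d * b.
  by move=> e2; rewrite -[RHS]mul1r -e2; ring.
exact: cancel.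
Qed.

(** The scalar is the same for all [I], hence independent of [tau]; this is why the star descends to
    restrictions. *)
Lemma ext_eval_hodge n k p (x0 : 'I_n) (h : 'M[C]_n) (tau : ext R n) :
  (k + p)%N = n -> h \in unitmx ->
  ext_eval (hodge tau) (lead_rows p (dual_frame h)) =
  reversal_sign p / \det h * ext_eval tau (lead_rows k h).
Proof.
move=> kpn h_unit; rewrite /ext_eval mulr_sumr.
rewrite (reindex_inj (inv_inj (@finset.setCK _))) /=.
apply: eq_big => [I|I /eqP cI].
  have := cardsC I; rewrite card_ord -[RHS]kpn; move: #|I| #|~: I| => i j; lia.
have kI : #|I| = k by have := cardsC I; rewrite cI card_ord -[RHS]kpn => /addIn.
rewrite ffunE finset.setCK mulrAC (theta_eval_dual_frame x0 kpn h_unit kI).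
by rewrite mulrC mulrCA.
Qed.

Lemma dual_frame_unit n (h : 'M[C]_n) : (dual_frame h \in unitmx) = (h \in unitmx).
Proof.
rewrite (_ : dual_frame h = row_perm (perm (@rev_ord_inj n)) (invmx h)^T).
  by rewrite row_permE unitmx_mul unitmx_perm unitmx_tr unitmx_inv.
by apply/matrixP => r s; rewrite !mxE permE.
Qed.

(** Inverse transpose is multiplicative, and moving the row reversal to the right factor reverses
    both indices of the left one. *)
Lemma dual_frame_mul n (g h : 'M[C]_n) : g \in unitmx -> h \in unitmx ->
  dual_frame (g *m h) =
  \matrix_(r, s) (invmx g) (rev_ord s) (rev_ord r) *m dual_frame h.
Proof.
move=> gu hu; rewrite /dual_frame.
have -> : invmx (g *m h) = invmx h *m invmx g.
  apply: (can_inj (mulKmx _) : injective (mulmx (g *m h))).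
    by rewrite unitmx_mul gu hu.
  by rewrite mulmxV ?unitmx_mul ?gu ?hu // mulmxA mulmxK // mulmxV.
apply/matrixP => r s; rewrite !mxE (reindex_inj (@rev_ord_inj n)) /=.
by apply: eq_bigr => i _; rewrite !mxE mulrC.
Qed.

Lemma dual_frameK n (h : 'M[C]_n) : h \in unitmx -> dual_frame (dual_frame h) = h.
Proof.
move=> hu; pose Q := \matrix_(r, s) (h^T r (rev_ord s)) : 'M[C]_n.
have QV : dual_frame h *m Q = 1%:M.
  apply/matrixP => r s; rewrite !mxE.
  have /matrixP/(_ (rev_ord s) (rev_ord r)) := mulmxV hu; rewrite !mxE.
  rewrite (inj_eq rev_ord_inj) eq_sym => <-.
  by apply: eq_bigr => i _; rewrite !mxE mulrC.
have QE : invmx (dual_frame h) = Q.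
  by rewrite -[LHS]mulmx1 -QV mulmxA mulVmx ?dual_frame_unit // mul1mx.
by apply/matrixP => r s; rewrite !mxE QE !mxE rev_ordK.
Qed.

End ComplementaryMinors.

(** * Frames of flags and fibres *)

Section Frames.
Variable R : realType.
Local Notation C := (complex R).

Lemma free_rows n (h : 'M[C]_n) : h \in unitmx -> free (rows h).
Proof.
move=> hu; have sz : size (rows h) == n by rewrite size_map size_enum_ord.
apply/(@freeP _ _ _ (Tuple sz)) => c c0 i.
have : (\row_i c i) *m h = 0.
  rewrite mulmx_sum_row -[RHS]c0; apply: eq_bigr => j _.
  by rewrite mxE /= nth_rows.
by move/(canRL (mulmxK hu)); rewrite mul0mx => /rowP/(_ i); rewrite !mxE.
Qed.

Lemma size_lead_rows n (h : 'M[C]_n) k : (k <= n)%N -> size (take k (rows h)) = k.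
Proof. by move=> kn; rewrite size_takel // size_map size_enum_ord. Qed.

Lemma dim_lead_rows n (h : 'M[C]_n) k : h \in unitmx -> (k <= n)%N ->
  \dim <<take k (rows h)>> = k.
Proof.
move=> hu kn; have := free_rows hu; rewrite -{1}(cat_take_drop k (rows h)).
by move/catl_free; rewrite /free => /eqP ->; exact: size_lead_rows.
Qed.

Lemma mem_lead_rows n (h : 'M[C]_n) k r : (r < k)%N -> (k <= n)%N ->
  (rows h)`_r \in <<take k (rows h)>>%VS.
Proof.
move=> rk kn; apply: memv_span; rewrite -(nth_take 0 rk); apply: mem_nth.
by rewrite size_lead_rows.
Qed.

Lemma lead_rows_span n (h : 'M[C]_n) k u : (k <= n)%N ->
  u \in <<take k (rows h)>>%VS -> exists c, u = \sum_(i < k) c i *: (rows h)`_i.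
Proof.
move=> kn; have /eqP sz := size_lead_rows h kn.
move=> /(@coord_span _ _ _ (Tuple sz)) ->.
eexists; apply: eq_bigr => i _; rewrite /= nth_take //.
Qed.

Lemma span_flagP n m (k : 'I_m -> nat) (h : 'M[C]_n) : h \in unitmx ->
  (forall i, (k i <= n)%N) -> (forall i j : 'I_m, (i <= j)%N -> (k i <= k j)%N) ->
  is_flag k (span_flag k h).
Proof.
move=> hu kn km; apply/andP; split.
  by apply/forallP => i; rewrite ffunE dim_lead_rows.
apply/forallP => i; apply/forallP => j; apply/implyP => ij; rewrite !ffunE.
rewrite -(subnKC (km _ _ ij)) takeD span_cat; exact: addvSl.
Qed.

(** The rows of [h] and of its inverse transpose are dual bases, so the last [l i] rows of the
    latter are orthogonal to the first [n - l i] rows of [h]; equality is then a count of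
    dimensions. *)
Lemma span_flag_dual n m (k l : 'I_m -> nat) (h : 'M[C]_n) : h \in unitmx ->
  (forall i, k (rev_ord i) + l i = n)%N ->
  span_flag l (dual_frame h) = perp_flag (span_flag k h).
Proof.
move=> hu kl; apply/ffunP => i; rewrite !ffunE; have kli := kl i.
apply/eqP; rewrite eqEdim dim_perp !dim_lead_rows ?dual_frame_unit //; try lia.
apply/andP; split; last by lia.
have ln : (l i <= n)%N by lia.
have kn : (k (rev_ord i) <= n)%N by lia.
apply/span_subvP => u /(nthP 0) [r]; rewrite size_lead_rows // => rl <-.
apply/perpP => v /(lead_rows_span kn) [c ->]; rewrite bilin_sumr big1 // => s _.
rewrite nth_take // (_ : bilin _ _ = 0) ?mulr0 //.
pose r' := Ordinal (leq_trans rl ln); pose s' := Ordinal (leq_trans (ltn_ord s) kn).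
rewrite -[r]/(val r') -[nat_of_ord s]/(val s') !nth_rows.
have /matrixP/(_ s' (rev_ord r')) := mulmxV hu; rewrite !mxE.
have -> : (s' == rev_ord r') = false.
  by apply/eqP => /(congr1 val) /=; have := ltn_ord s; lia.
by move=> e0; rewrite -[RHS]e0; apply: eq_bigr => j _; rewrite !mxE mulrC.
Qed.

Lemma free_extend n (X : seq 'rV[C]_n) U : free X -> (<<X>> <= U)%VS ->
  exists Y, free (X ++ Y) /\ <<X ++ Y>>%VS = U.
Proof.
move=> frX XU; exists (vbasis (U :\: <<X>>)); rewrite cat_free span_cat.
rewrite frX (basis_free (vbasisP _)) (span_basis (vbasisP _)) /=.
split; first by rewrite directv_addE /= !directvE /= !eqxx /= capvC capv_diff.
by rewrite addvC addv_diff; apply/addv_idPl.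
Qed.

Lemma exists_frame n m (k : 'I_m -> nat) (x : {ffun 'I_m -> {vspace 'rV[C]_n}}) :
  is_flag k x -> exists2 h : 'M[C]_n, h \in unitmx & span_flag k h = x.
Proof.
case/andP=> /forallP dx /forallP sx.
have xS (i j : 'I_m) : (i <= j)%N -> (x i <= x j)%VS.
  by move=> ij; have /forallP/(_ j)/implyP := sx i; exact.
have [X [frX X_lt _]] : exists X : seq 'rV[C]_n, [/\ free X,
    forall i : 'I_m, (i < m)%N -> (k i <= size X)%N /\ <<take (k i) X>>%VS = x i
  & forall i : 'I_m, (m <= i)%N -> (<<X>> <= x i)%VS].
  (* Induction on [j]: [X] is adapted to the first [j] subspaces and still lies in all later ones,
     so that it can be extended inside the next. *)
  suff: forall j, (j <= m)%N -> exists X : seq 'rV[C]_n, [/\ free X,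
      forall i : 'I_m, (i < j)%N -> (k i <= size X)%N /\ <<take (k i) X>>%VS = x i
    & forall i : 'I_m, (j <= i)%N -> (<<X>> <= x i)%VS] by apply.
  elim=> [|j IH] jm.
    exists [::]; split=> // [|i _]; first by rewrite nil_free.
    by rewrite span_nil sub0v.
  have [X [frX X_lt X_ge]] := IH (ltnW jm).
  have [Y [frXY XYj]] := free_extend frX (X_ge (Ordinal jm) (leqnn _)).
  have szXY : size (X ++ Y) = k (Ordinal jm).
    by rewrite -(eqP (dx _)) -XYj (eqP frXY).
  exists (X ++ Y); split=> // i; last first.
    by move=> ji; rewrite XYj; exact: (xS (Ordinal jm) i (ltnW ji)).
  rewrite ltnS leq_eqVlt => /orP[/eqP ij|/X_lt [kX <-]].
    have -> : i = Ordinal jm by exact: val_inj.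
    by rewrite szXY leqnn -szXY take_size.
  by rewrite takel_cat // size_cat (leq_trans kX) ?leq_addr.
have [Y [frXY XYf]] := free_extend frX (subvf _).
have /eqP sz : size (X ++ Y) = n by rewrite -(eqP frXY) XYf dimvf /dim /= mul1n.
pose h : 'M[C]_n := \matrix_i (X ++ Y)`_i.
have hE : rows h = X ++ Y.
  apply: (@eq_from_nth _ 0); first by rewrite size_map size_enum_ord (eqP sz).
  move=> r; rewrite size_map size_enum_ord => rn.
  by rewrite -[r]/(val (Ordinal rn)) nth_rows rowK.
exists h; last first.
  apply/ffunP => i; rewrite ffunE hE; have [kX <-] := X_lt i (ltn_ord i).
  by rewrite takel_cat.
rewrite -row_free_unit -kermx_eq0; apply/rowV0P => c /sub_kermxP cM.
apply/rowP => i; rewrite mxE.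
apply: ((@freeP _ _ _ (Tuple sz)) frXY (fun i => c 0 i)).
rewrite -[RHS]cM mulmx_sum_row; apply: eq_bigr => j _; congr (_ *: _).
by rewrite rowK.
Qed.

(** Trades the [conform_mx] cast for a column selection [g] covering [I], on which determinant
    lemmas act directly. *)
Lemma theta_eval_colsub n k (I : {set 'I_n}) : #|I| = k ->
  exists2 g : 'I_k -> 'I_n, forall i, i \in I -> exists s, g s = i
    & forall A : 'M[C]_(k, n), theta_eval I A = \det (colsub g A).
Proof.
move=> cI; case: k / cI; exists (@enum_val _ (mem I)) => [i Ii|A].
  by exists (enum_rank_in Ii i); rewrite enum_rankK_in.
by rewrite /theta_eval conform_mx_id.
Qed.

(** The leading rows are independent, so [k] suitable columns of them are too. [f] selects such
    columns; [g] lists the same set, perhaps in another order, hence the passage through row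
    spaces. *)
Lemma exists_minor_neq0 n k (h : 'M[C]_n) : h \in unitmx -> (k <= n)%N ->
  exists2 I : {set 'I_n}, #|I| = k & theta_eval I (lead_rows k h) != 0.
Proof.
move=> hu kn; set M := lead_rows k h.
have full : row_full M^T.
  rewrite /row_full mxrank_tr -/(row_free M).
  have /eqP sz := size_lead_rows h kn.
  have fr : free (take k (rows h)).
    by have := free_rows hu; rewrite -{1}(cat_take_drop k (rows h)) => /catl_free.
  rewrite -kermx_eq0; apply/rowV0P => c /sub_kermxP cM; apply/rowP => i; rewrite mxE.
  apply: ((@freeP _ _ _ (Tuple sz)) fr (fun i => c 0 i)).
  rewrite -[RHS]cM mulmx_sum_row; apply: eq_bigr => j _.
  by rewrite rowK /= nth_take.
pose f := fullrankfun full; pose I := [set f r | r in 'I_k].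
have cI : #|I| = k by rewrite card_imset ?card_ord //; exact: fullrankfun_inj.
have [g gI gE] := theta_eval_colsub cI; exists I => //.
rewrite gE -unitfE -unitmxE -unitmx_tr -row_full_unit.
have -> : (colsub g M)^T = rowsub g M^T by apply/matrixP => r s; rewrite !mxE.
rewrite -sub1mx (submx_trans _ (_ : rowsub f M^T <= _)%MS) //.
  by rewrite sub1mx row_full_unit fullrowsub_unit.
apply/row_subP => r; have [s gs] := gI (f r) (imset_f _ (erefl _)).
by rewrite row_rowsub -gs -row_rowsub row_sub.
Qed.

Lemma tensor_res_row_frames n m (k a : 'I_m -> nat) N (x : flag R n k) h tau :
  (forall i, (k i <= n)%N) -> flag_val x = span_flag k h ->
  tensor_res x tau (row_frames x h) =
  \prod_(p : tfactor a N) ext_eval (tau p) (lead_rows (k (tag p)) h).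
Proof.
move=> kn xh; apply: eq_bigr => p _; congr (ext_eval _ _).
apply/row_matrixP => r; rewrite !rowK vsprojK // xh ffunE.
by apply: mem_lead_rows.
Qed.

Lemma row_frames_span n m (k a : 'I_m -> nat) N (x : flag R n k) h :
  (forall i, (k i <= n)%N) -> flag_val x = span_flag k h ->
  forall (p : tfactor a N) u, exists c, u = \sum_i c i *: @row_frames _ _ _ _ _ _ x h p i.
Proof.
move=> kn xh p u; have := subvsP u; rewrite {2}xh ffunE.
case/(lead_rows_span (kn _)) => c uE; exists c; apply: val_inj; rewrite /= uE linear_sum.
apply: eq_bigr => i _; rewrite linearZ /= vsprojK // xh ffunE.
by apply: mem_lead_rows.
Qed.

Lemma res_alternating n (V : {vspace 'rV[C]_n}) k (tau : ext R n) :
  alternating_form (fun v : 'I_k -> subvs_of V => res tau v).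
Proof.
rewrite /res /ext_eval; split=> [v r c u u'|v r r' rr' vrr'].
  rewrite mulr_sumr -big_split /=; apply: eq_bigr => I /eqP cI.
  have [g _ gE] := theta_eval_colsub cI; rewrite mulrCA -mulrDr; congr (_ * _).
  rewrite !gE -[\det (colsub g (\matrix_s vsval ([eta v with r |-> u'] s)))]mul1r.
  apply: (@determinant_multilinear _ _ _ _ _ r).
  - by apply/rowP => s; rewrite !mxE /= eqxx linearP !mxE mul1r.
  - by apply/matrixP => i s; rewrite !mxE /= eq_sym (negPf (neq_lift _ _)).
  - by apply/matrixP => i s; rewrite !mxE /= eq_sym (negPf (neq_lift _ _)).
rewrite big1 // => I /eqP cI; have [g _ gE] := theta_eval_colsub cI.
by rewrite gE (determinant_alternate rr') ?mulr0 // => s; rewrite !mxE vrr'.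
Qed.

End Frames.

(** * Each fibre is a line *)

Section Fibres.
Variables (R : realType) (n m : nat) (k a : 'I_m -> nat) (N : nat) (x : flag R n k).
Local Notation C := (complex R).
Implicit Types phi psi : fibre_fun a N x.

Lemma in_fibreP (c : C) phi psi :
  in_fibre phi -> in_fibre psi -> in_fibre (c *: phi + psi).
Proof.
move=> phiF psiF p v; have [phiL phiA] := phiF p v; have [psiL psiA] := psiF p v.
have E w : (c *: phi + psi) w = c * phi w + psi w by [].
split=> [w r d u u'|w r r' rr' wrr'].
  by rewrite !E phiL psiL !mulrDr !mulrA (mulrC d c) addrACA.
by rewrite E (phiA _ _ _ rr') // (psiA _ _ _ rr') // mulr0 addr0.
Qed.

Lemma in_fibre0 : in_fibre (0 : fibre_fun a N x).
Proof.
move=> p v; have E w : (0 : fibre_fun a N x) w = 0 by [].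
by split=> [w r d u u'|//]; rewrite !E mulr0 addr0.
Qed.

Lemma in_fibre_tensor_res (tau : tfactor a N -> ext R n) : in_fibre (tensor_res x tau).
Proof.
move=> p v; have [resL resA] := @res_alternating _ _ (x (tag p)) (k (tag p)) (tau p).
have resE u : tensor_res x tau (@eqtype.dfwith _ _ v p u) =
    res (tau p) u * \prod_(q | q != p) res (tau q) (v q).
  rewrite [LHS](bigD1 p) //; congr (res _ _ * _).
    exact: eqtype.dfwith_in.
  by apply: eq_bigr => q qp; rewrite eqtype.dfwith_out // eq_sym.
split=> [w r d u u'|w r r' rr' wrr'].
  by rewrite !resE resL mulrDl mulrA.
by rewrite resE (resA _ _ _ rr') // mul0r.
Qed.

Lemma in_fibre_sum (t : seq (C * (tfactor a N -> ext R n))) :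
  in_fibre (\sum_(d <- t) d.1 *: tensor_res x d.2).
Proof.
elim: t => [|d t IH]; first by rewrite big_nil; exact: in_fibre0.
by rewrite big_cons; apply: in_fibreP => //; exact: in_fibre_tensor_res.
Qed.

Hypothesis kn : forall i, (k i <= n)%N.

Lemma fibre_frame_inj h phi psi : flag_val x = span_flag k h ->
  in_fibre phi -> in_fibre psi ->
  phi (row_frames x h) = psi (row_frames x h) -> phi = psi.
Proof.
move=> xh phiF psiF e; apply/eqP; rewrite -subr_eq0 addrC; apply/eqP.
rewrite -scaleN1r; apply: (@fibre_eq0 _ _ _ _ _ _ _ _ (row_frames x h)).
- exact: in_fibreP.
- exact: row_frames_span.
by rewrite [LHS]/(-1 * psi _ + phi _) e mulN1r; exact: addNr.
Qed.

Lemma exists_tensor_res_neq0 h : h \in unitmx -> flag_val x = span_flag k h ->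
  exists tau : tfactor a N -> ext R n, tensor_res x tau (row_frames x h) != 0.
Proof.
move=> hu xh.
have /fin_all_exists [I II] : forall p : tfactor a N, exists I : {set 'I_n},
    #|I| = k (tag p) /\ theta_eval I (lead_rows (k (tag p)) h) != 0.
  by move=> p; have [I] := exists_minor_neq0 hu (kn (tag p)); exists I.
exists (fun p => theta R (I p)).
rewrite tensor_res_row_frames //; apply/prodf_neq0 => p _.
have [cI nz] := II p; rewrite /ext_eval (bigD1 (I p)) ?cI //= big1 ?addr0.
  by rewrite ffunE eqxx mul1r.
by move=> J /andP[_ /negPf JI]; rewrite ffunE JI mul0r.
Qed.

Lemma exists_fibre_value h (c : C) : h \in unitmx -> flag_val x = span_flag k h ->
  exists (d : C) (tau : tfactor a N -> ext R n),
    (d *: tensor_res x tau) (row_frames x h) = c :> C.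
Proof.
move=> hu xh; have [tau nz] := exists_tensor_res_neq0 hu xh.
by exists (c / tensor_res x tau (row_frames x h)), tau; exact: divfK.
Qed.

Lemma in_fibreZ_tensor_res (c : C) (tau : tfactor a N -> ext R n) :
  in_fibre (c *: tensor_res x tau).
Proof.
rewrite -[X in in_fibre X]addr0.
by apply: in_fibreP; [exact: in_fibre_tensor_res|exact: in_fibre0].
Qed.

(** The existence half of the fibre being a line: a suitable multiple of a pure tensor agrees with
    [phi] on one frame, hence everywhere. *)
Lemma in_fibre_tensor_resP phi : in_fibre phi ->
  exists (c : C) tau, phi = c *: tensor_res x tau.
Proof.
move=> phiF; have [h hu xh] := exists_frame (flagP x).
have [c [tau e]] := exists_fibre_value (phi (row_frames x h)) hu (esym xh).
exists c, tau; apply: (fibre_frame_inj (esym xh)) => //; exact: in_fibreZ_tensor_res.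
Qed.

End Fibres.

(** * The star on fibres *)

Section StarOnFibres.
Variables (R : realType) (n m : nat) (k a : 'I_m -> nat) (N : nat).
Local Notation C := (complex R).
Local Notation l := (dual_dims n k).
Local Notation b := (dual_mults a).
Hypothesis k_bounds : forall i, (0 < k i < n)%N.

Let kn i : (k i <= n)%N. Proof. by case/andP: (k_bounds i) => _ /ltnW. Qed.
Let ln i : (l i <= n)%N. Proof. exact: leq_subr. Qed.
Let kl i : (k (rev_ord i) + l i = n)%N. Proof. by rewrite subnKC. Qed.

Lemma rev_factor_bij : bijective (@rev_factor m a N).
Proof.
have inj : injective (@rev_factor m a N).
  case=> i s [j t] /= e.
  have ij : i = j by apply: rev_ord_inj; exact: (congr1 tag e).
  case: j / ij t e => t /eqP; rewrite /rev_factor eq_Tagged /=.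
  by move/eqP/(@rev_ord_inj (N * a (rev_ord i))) => ->.
have surj (p : tfactor a N) : exists q : tfactor b N, rev_factor q == p.
  case: p => i s; have [j ij] : exists j, rev_ord j = i.
    by exists (rev_ord i); rewrite rev_ordK.
  case: i / ij s => s; exists (Tagged (fun i => 'I_(N * b i)) (rev_ord s : 'I_(N * b j))).
  by rewrite /rev_factor /= rev_ordK.
exists (fun p => xchoose (surj p)) => [q|p]; last exact: eqP (xchooseP (surj p)).
by apply: inj; exact: eqP (xchooseP (surj _)).
Qed.

(** The factor by which [Psi_hat] scales values between the frames of [h] and of [dual_frame h]. *)
Definition frame_const (h : 'M[C]_n) : C :=
  \prod_(q : tfactor b N) (reversal_sign R (l (tag q)) / \det h).

Lemma frame_const_neq0 h : h \in unitmx -> frame_const h != 0.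
Proof.
move=> hu; apply/prodf_neq0 => q _; rewrite mulf_neq0 ?signr_eq0 //.
by rewrite invr_eq0 -unitfE -unitmxE.
Qed.

Lemma frame_const_det h h' : \det h = \det h' -> frame_const h = frame_const h'.
Proof. by rewrite /frame_const => ->. Qed.

Variables (x : flag R n k) (y : flag R n l) (h : 'M[C]_n).
Hypothesis (h_unit : h \in unitmx) (xh : flag_val x = span_flag k h).
Hypothesis yh : flag_val y = span_flag l (dual_frame h).

Lemma tensor_res_hodge (tau : tfactor a N -> ext R n) :
  tensor_res y (fun q => hodge (tau (rev_factor q))) (row_frames y (dual_frame h)) =
  frame_const h * tensor_res x tau (row_frames x h).
Proof.
rewrite !tensor_res_row_frames // (reindex _ (onW_bij _ rev_factor_bij)) /=.
rewrite -big_split /=; apply: eq_bigr => q _.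
have n0 : (0 < n)%N by case/andP: (k_bounds (tag q)) => _; exact: leq_trans.
exact: (ext_eval_hodge (Ordinal n0) _ (kl _)).
Qed.

(** The right-hand side does not mention the decomposition into pure tensors: this is the
    well-definedness of [Psi_hat]. *)
Lemma Psi_hat_graph_frame (phi : fibre_fun a N x) (psi : fibre_fun b N y) :
  Psi_hat_graph phi psi ->
  psi (row_frames y (dual_frame h)) = frame_const h * phi (row_frames x h).
Proof.
case=> t [-> ->]; elim: t => [|d t IH]; first by rewrite !big_nil [RHS]mulr0.
rewrite !big_cons.
rewrite [LHS]/(d.1 * tensor_res y _ _ + (\sum_(d <- t) _ : fibre_fun b N y) _).
rewrite IH tensor_res_hodge mulrCA; symmetry.
exact: (mulrDr (frame_const h) (d.1 * tensor_res x d.2 _)).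
Qed.

Lemma Psi_hatP (phi : fibre_fun a N x) : in_fibre phi ->
  in_fibre (Psi_hat x y phi) /\
  Psi_hat x y phi (row_frames y (dual_frame h)) = frame_const h * phi (row_frames x h).
Proof.
move=> phiF; suff Pg : Psi_hat_graph phi (Psi_hat x y phi).
  split; last exact: Psi_hat_graph_frame.
  case: Pg => t [_ ->].
  have := @in_fibre_sum _ _ _ _ _ _ y [seq (d.1, fun q => hodge (d.2 (rev_factor q))) | d <- t].
  by rewrite big_map.
have [c [tau phiE]] := in_fibre_tensor_resP kn phiF.
(* The graph relates [phi] to some element, so [xget] does not return its default 0. *)
rewrite /Psi_hat; case: xgetP => [psi -> //|].
case/(_ (c *: tensor_res y (fun q => hodge (tau (rev_factor q))))).
by exists [:: (c, tau)]; rewrite !big_seq1.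
Qed.

Lemma Psi_hat_eq (phi : fibre_fun a N x) (psi : fibre_fun b N y) :
  in_fibre phi -> in_fibre psi ->
  psi (row_frames y (dual_frame h)) = frame_const h * phi (row_frames x h) ->
  Psi_hat x y phi = psi.
Proof.
move=> phiF psiF e; have [F e'] := Psi_hatP phiF.
by apply: (fibre_frame_inj ln yh) => //; rewrite e e'.
Qed.

End StarOnFibres.

(** * Charts and holomorphy *)

Section Differentiability.
Variables (R : realType) (V : normedModType (complex R)).
Local Notation C := (complex R).

Lemma differentiable_bigsum (W : normedModType C) (I : Type) (r : seq I) (P : pred I)
    (F : I -> V -> W) z :
  (forall i, P i -> differentiable (F i) z) ->
  differentiable (fun v => \sum_(i <- r | P i) F i v) z.
Proof.
move=> dF; elim: r => [|i r IH].
  by under eq_fun do rewrite big_nil; exact: differentiable_cst.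
under eq_fun do rewrite big_cons.
by case Pi: (P i) => //; apply: differentiableD => //; exact: dF.
Qed.

Lemma differentiable_bigprod (I : Type) (r : seq I) (P : pred I) (F : I -> V -> C^o) z :
  (forall i, P i -> differentiable (F i) z) ->
  differentiable (fun v => \prod_(i <- r | P i) F i v : C^o) z.
Proof.
move=> dF; elim: r => [|i r IH].
  by under eq_fun do rewrite big_nil; exact: differentiable_cst.
under eq_fun do rewrite big_cons.
by case Pi: (P i) => //; apply: differentiableM => //; exact: dF.
Qed.

Lemma differentiable_det p (f : V -> 'M[C]_p) z :
  (forall i j, differentiable (fun v => f v i j : C^o) z) ->
  differentiable (fun v => \det (f v) : C^o) z.
Proof.
move=> df; apply: differentiable_bigsum => s _.
apply: differentiableM; first exact: differentiable_cst.
by apply: differentiable_bigprod => i _.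
Qed.

Lemma differentiable_matrix p q (f : V -> 'M[C]_(p, q)) z :
  (forall i j, differentiable (fun v => f v i j : C^o) z) -> differentiable f z.
Proof.
move=> df; rewrite (funext (fun v => matrix_sum_delta (f v))).
apply: differentiable_bigsum => i _; apply: differentiable_bigsum => j _.
exact: differentiableZl.
Qed.

Lemma differentiable_mulmxl p q r (f : V -> 'M[C]_(p, q)) (g : 'M[C]_(q, r)) z :
  (forall i j, differentiable (fun v => f v i j : C^o) z) ->
  forall i j, differentiable (fun v => (f v *m g) i j : C^o) z.
Proof.
move=> df i j; under eq_fun do rewrite mxE.
apply: differentiable_bigsum => s _.
by apply: differentiableM => //; exact: differentiable_cst.
Qed.

End Differentiability.

(** * Charts of the flag manifold under duality *)

Section Charts.
Variables (R : realType) (n m : nat).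
Local Notation C := (complex R).
Implicit Types k l : 'I_m -> nat.

Lemma differentiable_chart_mx k i j Z :
  differentiable (fun Z : 'M[C]_n => chart_mx k Z i j : C^o) Z.
Proof.
under eq_fun do rewrite mxE; apply: differentiableD; first exact: differentiable_cst.
by case: [exists u, (i < k u <= j)%N]; [exact: differentiable_coord | exact: differentiable_cst].
Qed.

Lemma det_chart_mx k (Z : 'M[C]_n) : \det (chart_mx k Z) = 1.
Proof.
rewrite -det_tr det_trig.
  rewrite big1 // => i _; rewrite !mxE eqxx; case: existsP => [[r]|]; last by rewrite addr0.
  by rewrite ltnNge andNb.
apply/is_trig_mxP => i j ij; rewrite !mxE; case: existsP => [[r]|_]; first by lia.
by rewrite -val_eqE /= gtn_eqF // addr0.
Qed.

Lemma chart_mx_unit k (Z : 'M[C]_n) : chart_mx k Z \in unitmx.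
Proof. by rewrite unitmxE det_chart_mx unitr1. Qed.

(** The inverse of a block unipotent matrix has the same shape. Rows are treated from the bottom up,
    by expanding row [r] of the product of the matrix with its inverse. *)
Lemma invmx_chart_mx k (Z : 'M[C]_n) (r s : 'I_n) :
  ~~ [exists i, (r < k i <= s)%N] -> invmx (chart_mx k Z) r s = (r == s)%:R.
Proof.
move: {2}(n - r)%N (leqnn (n - r)) => d; elim: d r => [|d IH] r nrd.
  by have := ltn_ord r; lia.
move=> /existsPn nE; have /matrixP/(_ r s) := mulmxV (chart_mx_unit k Z).
rewrite !mxE => <-; rewrite (bigD1 r) //= mxE eqxx.
rewrite ifF ?addr0 ?mul1r; last by apply/existsP => -[u]; rewrite ltnNge andNb.
rewrite big1 ?addr0 // => t tr; rewrite mxE eq_sym (negPf tr) add0r.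
case: existsP => [[i /andP[ri i_t]]|]; last by rewrite mul0r.
have nts : ~~ [exists i, (t < k i <= s)%N].
  by apply/existsPn => j; have := nE i; have := nE j; lia.
rewrite IH //; last by lia.
case: eqP => [ts|]; last by rewrite mulr0.
by have := nE i; rewrite ri -ts i_t.
Qed.

(** The left factor of [dual_frame_mul] for a chart matrix; it gives the coordinates of the dual
    flag in the chart at [dual_frame g]. *)
Definition dual_chart l (Z : 'M[C]_n) : 'M[C]_n :=
  \matrix_(r, s) invmx (chart_mx l Z) (rev_ord s) (rev_ord r).

(** With determinant 1 the inverse is the adjugate, whose entries are polynomials in [Z]. *)
Lemma differentiable_dual_chart l Z : differentiable (dual_chart l) Z.
Proof.
rewrite (_ : dual_chart l = fun Z => \matrix_(r, s)
    ((-1) ^+ (rev_ord r + rev_ord s) *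
     \det (row' (rev_ord r) (col' (rev_ord s) (chart_mx l Z))))); last first.
  apply/funext => A; apply/matrixP => r s.
  by rewrite !mxE /invmx chart_mx_unit det_chart_mx invr1 scale1r mxE.
apply: differentiable_matrix => i j; under eq_fun do rewrite mxE.
apply: differentiableM; first exact: differentiable_cst.
apply: differentiable_det => r s.
under eq_fun do rewrite 2!mxE.
exact: differentiable_chart_mx.
Qed.

Lemma dual_frame_chart k l (g Z : 'M[C]_n) :
  (forall i, k (rev_ord i) + l i = n)%N -> g \in unitmx ->
  dual_frame (chart_mx l Z *m g) = chart_mx k (dual_chart l Z) *m dual_frame g.
Proof.
move=> kl gu; rewrite (dual_frame_mul (chart_mx_unit l Z) gu); congr (_ *m _).
apply/matrixP => r s; rewrite mxE [RHS]mxE.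
have rsE : [exists i, (r < k i <= s)%N] = [exists i, (rev_ord s < l i <= rev_ord r)%N].
  apply/existsP/existsP => -[i ris]; exists (rev_ord i); move: ris (kl (rev_ord i)) (kl i);
  by rewrite ?rev_ordK /=; have := ltn_ord r; have := ltn_ord s; lia.
rewrite rsE; case: ifPn => [/existsP[i is_]|ne].
  rewrite [X in _ = _ + X]mxE -val_eqE /= ltn_eqF ?add0r //.
  by move: is_ => /=; have := ltn_ord r; have := ltn_ord s; lia.
by rewrite addr0 invmx_chart_mx // (inj_eq rev_ord_inj) eq_sym.
Qed.

Lemma det_dual_frame (h h' : 'M[C]_n) : \det h = \det h' ->
  \det (dual_frame h) = \det (dual_frame h').
Proof.
have E (A : 'M[C]_n) : dual_frame A = row_perm (perm (@rev_ord_inj n)) (invmx A)^T.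
  by apply/matrixP => r s; rewrite !mxE permE.
by rewrite !E !row_permE !det_mulmx !det_tr !det_inv => ->.
Qed.

Lemma chart_coefE k a N (s : section R n k a N) (g Z : 'M[C]_n) : g \in unitmx ->
  (forall i, (k i <= n)%N) -> (forall i j : 'I_m, (i <= j)%N -> (k i <= k j)%N) ->
  exists2 x : flag R n k, flag_val x = span_flag k (chart_mx k Z *m g)
    & chart_coef s g Z = s x (row_frames x (chart_mx k Z *m g)).
Proof.
move=> gu kn km; set h := chart_mx k Z *m g.
have hu : h \in unitmx by rewrite unitmx_mul chart_mx_unit.
have hP := span_flagP hu kn km; exists (Flag hP) => //.
by rewrite /chart_coef -/h insubT.
Qed.

Lemma tensor_res_holomorphic k a N (tau : tfactor a N -> ext R n) :
  (forall i, (k i <= n)%N) -> (forall i j : 'I_m, (i <= j)%N -> (k i <= k j)%N) ->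
  holomorphic_section (fun x : flag R n k => tensor_res x tau).
Proof.
move=> kn km; split=> [x|g gu Z]; first exact: in_fibre_tensor_res.
rewrite (_ : chart_coef _ g = fun Z => \prod_(p : tfactor a N)
    ext_eval (tau p) (lead_rows (k (tag p)) (chart_mx k Z *m g))); last first.
  apply/funext => A.
  have [x xh ->] := chart_coefE (fun x : flag R n k => tensor_res x tau) A gu kn km.
  exact: tensor_res_row_frames.
apply: differentiable_bigprod => p _; apply: differentiable_bigsum => I /eqP cI.
apply: differentiableM; first exact: differentiable_cst.
have [f _ fE] := theta_eval_colsub R cI; under eq_fun do rewrite fE.
apply: differentiable_det => r s; under eq_fun do rewrite mxE.
under eq_fun do rewrite (@lead_rowsE _ _ _ _ r (widen_ord (kn _) r) _ erefl).
by apply: differentiable_mulmxl => i j; exact: differentiable_chart_mx.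
Qed.

(** In the charts at [g] and [dual_frame g], [t] is a constant multiple of [s] composed with
    [dual_chart]. The abstract [D], [s] and [t] let this serve both for [Psi_tilde] and for its
    inverse. *)
Lemma holomorphic_transfer k a l b N (D : 'M[C]_n -> C)
    (s : section R n k a N) (t : section R n l b N) :
  (forall i, k (rev_ord i) + l i = n)%N ->
  (forall i j : 'I_m, (i <= j)%N -> (k i <= k j)%N) ->
  (forall i j : 'I_m, (i <= j)%N -> (l i <= l j)%N) ->
  (forall h h', \det h = \det h' -> D h = D h') ->
  (forall h, h \in unitmx -> forall x y, flag_val x = span_flag k h ->
     flag_val y = span_flag l (dual_frame h) ->
     t y (row_frames y (dual_frame h)) = D h * s x (row_frames x h)) ->
  (forall y, in_fibre (t y)) -> holomorphic_section s -> holomorphic_section t.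
Proof.
move=> kl km lm Ddet st tF [_ sH]; split=> // g gu Z.
have kn i : (k i <= n)%N by rewrite -(kl (rev_ord i)) rev_ordK leq_addr.
have ln i : (l i <= n)%N by rewrite -(kl i) leq_addl.
rewrite (_ : chart_coef t g = fun Z =>
  D (dual_frame g) * (chart_coef s (dual_frame g) \o dual_chart l) Z); last first.
  apply/funext => A /=.
  have gu' : dual_frame g \in unitmx by rewrite dual_frame_unit.
  have [y yh ->] := chart_coefE t A gu ln lm.
  have [x xh ->] := chart_coefE s (dual_chart l A) gu' kn km.
  have hu : chart_mx l A *m g \in unitmx by rewrite unitmx_mul chart_mx_unit.
  rewrite -(dual_frame_chart A kl gu) in xh *.
  have hu' : dual_frame (chart_mx l A *m g) \in unitmx by rewrite dual_frame_unit.
  (* [st] is applied to the dual of the chart frame: dualising again returns the frame on which [t]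
     is read. *)
  move: (st _ hu' x y xh); rewrite (dual_frameK hu) => /(_ yh) ->; congr (_ * _).
  by apply: Ddet; apply: det_dual_frame; rewrite det_mulmx det_chart_mx mul1r.
apply: differentiableM; first exact: differentiable_cst.
apply: differentiable_comp; first exact: differentiable_dual_chart.
by apply: sH; rewrite dual_frame_unit.
Qed.

End Charts.

(** * Tableaux *)

Section Tableaux.
Variable n : nat.
Implicit Types A : {set 'I_n}.

Definition ord_lt (i j : 'I_n) : bool := (i < j)%N.

Lemma ord_lt_trans : transitive ord_lt.
Proof. by move=> j i k; exact: ltn_trans. Qed.

Lemma sorted_enum A : sorted ord_lt (enum A).
Proof.
rewrite /enum_mem; apply: (sorted_filter ord_lt_trans).
have : sorted ltn (map val (enum 'I_n)) by rewrite val_enum_ord iota_ltn_sorted.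
by rewrite sorted_map enumT.
Qed.

(** Turns entrywise comparison of columns into comparison of counts below [j]. Positions start at 0,
    whence the strict inequality on the right. *)
Lemma nth_enum_lt A x0 r j : (r < #|A|)%N ->
  (nth x0 (enum A) r < j)%N = (r < #|A :&: [set i : 'I_n | (i < j)%N]|)%N.
Proof.
have -> : #|A :&: [set i : 'I_n | (i < j)%N]| = count (fun i : 'I_n => (i < j)%N) (enum A).
  rewrite cardE -size_filter; apply/perm_size/uniq_perm.
  - exact: enum_uniq.
  - by rewrite filter_uniq // enum_uniq.
  by move=> i; rewrite mem_enum mem_filter !inE mem_enum andbC.
rewrite cardE; elim: (enum A) (sorted_enum A) r => [|i s IH] //= s_sorted r.
have := order_path_min ord_lt_trans s_sorted; have := path_sorted s_sorted.
move=> /IH {}IH /allP i_min; case: (ltnP i j) => [ij|ji].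
  by case: r => [|r] //=; exact: IH.
have -> : count (fun i : 'I_n => (i < j)%N) s = 0%N.
  apply/eqP; rewrite -leqn0 leqNgt -has_count; apply/hasPn => t /i_min it.
  by rewrite -leqNgt (leq_trans ji) // ltnW.
case: r => [_|r] /=; first by rewrite ltnNge ji.
rewrite ltnS => /(mem_nth x0)/i_min it.
by rewrite ltn0 ltnNge (leq_trans ji) // ltnW.
Qed.

Variables (m : nat) (k a : 'I_m -> nat) (N : nat).
Hypothesis k_incr : forall i j : 'I_m, (i < j)%N -> (k i < k j)%N.
Variable T : filling n k a N.
Hypothesis T_ss : semistandard T.

Lemma column_inj p : injective (@T p).
Proof.
move=> r s rs; have [incr _] := T_ss; apply: val_inj => /=.
by case: (ltngtP r s) => // /incr; rewrite rs ltnn.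
Qed.

Lemma card_col_set p : #|col_set T p| = k (tag p).
Proof. by rewrite card_imset ?card_ord //; exact: column_inj. Qed.

Lemma card_col_setC p : #|~: col_set T p| = (n - k (tag p))%N.
Proof. by rewrite -(card_col_set p) cardsCs card_ord finset.setCK. Qed.

Lemma enum_col_set p : enum (col_set T p) = [seq @T p r | r <- enum 'I_(k (tag p))].
Proof.
apply: (irr_sorted_eq ord_lt_trans).
- by move=> i; exact: ltnn.
- exact: sorted_enum.
- rewrite sorted_map; have [incr _] := T_ss.
  move: (iota_ltn_sorted 0 (k (tag p))); rewrite -val_enum_ord sorted_map.
  by apply: sub_sorted => r s; exact: incr.
move=> i; rewrite mem_enum; apply/imsetP/mapP => -[r _ ->]; exists r => //.
by rewrite mem_enum.
Qed.

(** Row by row the entries of [q] dominate those of [p], and [q] is no longer than [p], so [q] has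
    at most as many entries in the initial segment [J]; complements inside [J] reverse this. *)
Lemma left_of_card_col_setC p q j : left_of p q ->
  (#|~: col_set T p :&: [set i : 'I_n | (i < j)%N]| <=
   #|~: col_set T q :&: [set i : 'I_n | (i < j)%N]|)%N.
Proof.
move=> pq; set J := [set i : 'I_n | (i < j)%N].
suff : (#|J :&: col_set T q| <= #|J :&: col_set T p|)%N.
  have := cardsID (col_set T p) J; have := cardsID (col_set T q) J.
  rewrite !finset.setDE !(finset.setIC J (~: _)).
  move: #|~: col_set T p :&: J| #|~: col_set T q :&: J|.
  move: #|J :&: col_set T p| #|J :&: col_set T q| #|J| => *; lia.
have kqp : (k (tag q) <= k (tag p))%N.
  by case/orP: pq => [/k_incr/ltnW //|/andP[/eqP e _]]; rewrite e.
have -> : J :&: col_set T q = [set @T q r | r in [set r | (@T q r < j)%N]].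
  apply/finset.setP => i; rewrite !inE; apply/andP/imsetP.
    by case=> ij /imsetP[r _ ir]; exists r; rewrite // inE -ir.
  by case=> r; rewrite inE => rj ->; split=> //; exact: imset_f.
apply: leq_trans (leq_imset_card _ _) _.
have f_inj : injective (fun r => @T p (widen_ord kqp r)).
  by move=> r s /column_inj /(congr1 val) rs; exact: val_inj.
rewrite -(card_imset _ f_inj); apply: subset_leq_card; apply/fintype.subsetP => i.
case/imsetP => r; rewrite inE => rj ->; rewrite !inE imset_f // andbT.
by apply: leq_ltn_trans rj; have [_ wk] := T_ss; exact: wk.
Qed.

Lemma rev_factor_left_of (p q : tfactor (dual_mults a) N) :
  left_of p q -> left_of (rev_factor q) (rev_factor p).
Proof.
case: p q => i r [j s]; rewrite /left_of /=.
case/orP => [ij|/andP[/eqP ij rs]]; apply/orP.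
  by left; have := ltn_ord i; have := ltn_ord j; lia.
right; case: j / ij s rs => s rs; rewrite eqxx /=.
by have := ltn_ord r; have := ltn_ord s; move: rs; lia.
Qed.

Lemma dual_filling_semistandard : semistandard (dual_filling T).
Proof.
have sz (q : tfactor (dual_mults a) N) :
    #|~: col_set T (rev_factor q)| = dual_dims n k (tag q) by rewrite card_col_setC.
split=> [q r s rs|p q r s pq rs].
  rewrite /dual_filling (set_nth_default (widen_ord (leq_subr _ _) s)).
    apply: (sorted_ltn_nth ord_lt_trans _ (sorted_enum _)) => //;
    by rewrite inE -cardE sz.
  by rewrite -cardE sz.
(* An inequality [u <= w] is read as [u < w.+1], so the counts are taken with [j] equal to
   [w.+1]. *)
rewrite -ltnS /dual_filling nth_enum_lt ?sz // rs.
apply: leq_trans (left_of_card_col_setC _ (rev_factor_left_of pq)).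
by rewrite -(@nth_enum_lt _ (widen_ord (leq_subr _ _) s)) // sz.
Qed.

Lemma col_set_dual_filling q :
  col_set (dual_filling T) q = ~: col_set T (rev_factor q).
Proof.
apply/finset.setP => i; rewrite -[RHS]mem_enum; apply/imsetP/idP => [[r _ ->]|].
  by rewrite mem_nth // -cardE card_col_setC.
move=> iE; have := iE; rewrite -index_mem -cardE card_col_setC => ilt.
by exists (Ordinal ilt) => //; rewrite /dual_filling /= nth_index.
Qed.

(** Columns of a semistandard tableau increase, so each is the enumeration of its set of entries. *)
Lemma epsilonE (R : realType) :
  epsilon R T = \prod_(p : tfactor a N) sgn_sets R (col_set T p) (~: col_set T p).
Proof. by apply: eq_bigr => p _; rewrite /sgn_sets enum_col_set. Qed.

End Tableaux.

(** * The map on sections *)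

Section Main.
Variables (R : realType) (n m : nat) (k a : 'I_m -> nat) (N : nat).
Local Notation C := (complex R).
Local Notation l := (dual_dims n k).
Local Notation b := (dual_mults a).
Hypothesis k_bounds : forall i, (0 < k i < n)%N.
Hypothesis k_incr : forall i j : 'I_m, (i < j)%N -> (k i < k j)%N.

Let kn i : (k i <= n)%N. Proof. by case/andP: (k_bounds i) => _ /ltnW. Qed.
Let kl i : (k (rev_ord i) + l i = n)%N. Proof. by rewrite subnKC. Qed.
Let lk i : (l (rev_ord i) + k i = n)%N. Proof. by rewrite /dual_dims rev_ordK subnK. Qed.
Let km (i j : 'I_m) : (i <= j)%N -> (k i <= k j)%N.
Proof. by rewrite leq_eqVlt => /orP[/eqP/val_inj->|/k_incr/ltnW]. Qed.
Let lm (i j : 'I_m) : (i <= j)%N -> (l i <= l j)%N.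
Proof. by move=> ij; apply: leq_sub2l; apply: km; apply: leq_sub2l. Qed.

Lemma Psi_inv_frame (y : flag R n l) : exists h : 'M[C]_n,
  [/\ h \in unitmx, flag_val (Psi_inv k_bounds y) = span_flag k h
    & flag_val y = span_flag l (dual_frame h)].
Proof.
have [h hu xh] := exists_frame (flagP (Psi_inv k_bounds y)); exists h; split=> //.
by rewrite (span_flag_dual hu kl) xh /= perp_flagK.
Qed.

Lemma Psi_inv_span_flag (x : flag R n k) (y : flag R n l) h : h \in unitmx ->
  flag_val x = span_flag k h -> flag_val y = span_flag l (dual_frame h) ->
  Psi_inv k_bounds y = x.
Proof.
move=> hu xh yh; apply: val_inj => /=.
by rewrite yh (span_flag_dual hu kl) perp_flagK -xh.
Qed.

Lemma Psi_tilde_in_fibre (s : section R n k a N) : (forall x, in_fibre (s x)) ->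
  forall y, in_fibre (Psi_tilde k_bounds s y).
Proof.
move=> sF y; have [h [hu xh yh]] := Psi_inv_frame y.
by case: (Psi_hatP k_bounds hu xh yh (sF _)).
Qed.

Lemma Psi_tilde_frame (s : section R n k a N) (x : flag R n k) (y : flag R n l) h :
  (forall x, in_fibre (s x)) -> h \in unitmx ->
  flag_val x = span_flag k h -> flag_val y = span_flag l (dual_frame h) ->
  Psi_tilde k_bounds s y (row_frames y (dual_frame h)) =
  frame_const k a N h * s x (row_frames x h).
Proof.
move=> sF hu xh yh; rewrite /Psi_tilde (Psi_inv_span_flag hu xh yh).
by case: (Psi_hatP k_bounds hu xh yh (sF _)).
Qed.

Lemma Psi_tilde_holomorphic (s : section R n k a N) :
  holomorphic_section s -> holomorphic_section (Psi_tilde k_bounds s).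
Proof.
move=> sH; have [sF _] := sH.
apply: (holomorphic_transfer (D := frame_const k a N) kl km lm _ _ _ sH).
- exact: frame_const_det.
- by move=> h hu x y xh yh; exact: Psi_tilde_frame.
- exact: Psi_tilde_in_fibre.
Qed.

(** The inverse map rescales by the inverse of [frame_const], again a function of the determinant,
    so the transfer applies with [k] and [l] exchanged. *)
Lemma holomorphic_Psi_tilde (s : section R n k a N) : (forall x, in_fibre (s x)) ->
  holomorphic_section (Psi_tilde k_bounds s) -> holomorphic_section s.
Proof.
move=> sF tH.
apply: (holomorphic_transfer (D := fun h => (frame_const k a N (dual_frame h))^-1)
  lk lm km _ _ sF tH) => [h h' /det_dual_frame/frame_const_det -> //|h hu y x yh xh].
have hu' : dual_frame h \in unitmx by rewrite dual_frame_unit.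
rewrite -{1}(dual_frameK hu) in yh.
have := Psi_tilde_frame sF hu' xh yh; rewrite (dual_frameK hu) => ->.
by rewrite mulKf ?frame_const_neq0.
Qed.

Lemma Psi_tilde_inj (s t : section R n k a N) :
  (forall x, in_fibre (s x)) -> (forall x, in_fibre (t x)) ->
  Psi_tilde k_bounds s = Psi_tilde k_bounds t -> s = t.
Proof.
move=> sF tF st; apply/functional_extensionality_dep => x.
have [h hu xh] := exists_frame (flagP x).
have yh : flag_val (Psi x) = span_flag l (dual_frame h).
  by rewrite (span_flag_dual hu kl) xh.
apply: (fibre_frame_inj kn (esym xh)) => //.
apply: (mulfI (frame_const_neq0 k a N hu)).
by rewrite -!(Psi_tilde_frame _ hu (esym xh) yh) // st.
Qed.

Lemma Psi_tilde_surj (t : section R n l b N) : (forall y, in_fibre (t y)) ->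
  exists2 s : section R n k a N, (forall x, in_fibre (s x)) & Psi_tilde k_bounds s = t.
Proof.
move=> tF.
(* Preimages are chosen over [Psi x], where the fibre types match; [Psi_invK] then brings every [y]
   to this form. *)
have preim (x : flag R n k) : exists phi : fibre_fun a N x,
    in_fibre phi /\ Psi_hat x (Psi x) phi = t (Psi x).
  have [h hu xh] := exists_frame (flagP x).
  have yh : flag_val (Psi x) = span_flag l (dual_frame h).
    by rewrite (span_flag_dual hu kl) xh.
  have [c [tau e]] := exists_fibre_value a N kn
    ((frame_const k a N h)^-1 * t (Psi x) (row_frames (Psi x) (dual_frame h))) hu (esym xh).
  exists (c *: tensor_res x tau); split; first exact: in_fibreZ_tensor_res.
  apply: (Psi_hat_eq k_bounds hu (esym xh) yh) => //; first exact: in_fibreZ_tensor_res.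
  by rewrite e mulVKf // frame_const_neq0.
pose s : section R n k a N := fun x => projT1 (cid (preim x)).
have sP x : in_fibre (s x) /\ Psi_hat x (Psi x) (s x) = t (Psi x).
  exact: projT2 (cid (preim x)).
exists s => [x|]; first by case: (sP x).
apply/functional_extensionality_dep => y; rewrite /Psi_tilde.
by case: (sP (Psi_inv k_bounds y)) => _; rewrite Psi_invK.
Qed.

Lemma Psi_tilde_linear (c : C) (s t : section R n k a N) :
  (forall x, in_fibre (s x)) -> (forall x, in_fibre (t x)) ->
  Psi_tilde k_bounds (c *: s + t) = c *: Psi_tilde k_bounds s + Psi_tilde k_bounds t.
Proof.
move=> sF tF; apply/functional_extensionality_dep => y.
have [h [hu xh yh]] := Psi_inv_frame y.
rewrite [LHS]/(Psi_hat _ y (c *: s _ + t _)).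
rewrite [RHS]/(c *: Psi_tilde k_bounds s y + Psi_tilde k_bounds t y).
apply: (Psi_hat_eq k_bounds hu xh yh).
- exact: in_fibreP.
- by apply: in_fibreP; exact: Psi_tilde_in_fibre.
have E := Psi_tilde_frame _ hu xh yh; transitivity
  (c * Psi_tilde k_bounds s y (row_frames y (dual_frame h)) +
   Psi_tilde k_bounds t y (row_frames y (dual_frame h))) => //.
rewrite !E // mulrCA; symmetry.
exact: (mulrDr (frame_const k a N h) (c * s _ _)).
Qed.

Lemma res_hodge_theta (V : {vspace 'rV[C]_n}) p (I : {set 'I_n}) (v : 'I_p -> subvs_of V) :
  res (hodge (theta R I)) v = sgn_sets R I (~: I) * res (theta R (~: I)) v.
Proof.
rewrite hodge_theta /res /ext_eval mulr_sumr.
by apply: eq_bigr => J _; rewrite [X in X * _]ffunE mulrA.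
Qed.

(** By [Psi_hat_eq] it suffices to compare values on one frame. There the star acts factor by
    factor, and a column with entry set [I] yields the complementary column and the sign
    [sgn_sets I (~: I)]. *)
Lemma Psi_tilde_standard (T : filling n k a N) : semistandard T ->
  Psi_tilde k_bounds (standard_section T) =
  epsilon R T *: standard_section (dual_filling T).
Proof.
move=> T_ss; apply/functional_extensionality_dep => y.
have [h [hu xh yh]] := Psi_inv_frame y.
rewrite [RHS]/(epsilon R T *: tensor_res y (fun q => theta R (col_set (dual_filling T) q))).
apply: (Psi_hat_eq k_bounds hu xh yh).
- exact: in_fibre_tensor_res.
- exact: in_fibreZ_tensor_res.
rewrite -(tensor_res_hodge k_bounds hu xh yh).
have -> : epsilon R T = \prod_(q : tfactor b N)
    sgn_sets R (col_set T (rev_factor q)) (~: col_set T (rev_factor q)).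
  by rewrite (epsilonE T_ss) (reindex _ (onW_bij _ (rev_factor_bij a N))).
apply: etrans (esym (big_split _ _ _ _ _)) _.
by apply: eq_bigr => q _; rewrite (col_set_dual_filling T_ss) res_hodge_theta.
Qed.

End Main.

Theorem theorem1p12 (R : realType) (n m : nat) (k a : 'I_m -> nat) (N : nat)
    (m_gt0 : (0 < m)%N)
    (k_bounds : forall i, (0 < k i < n)%N)
    (k_incr : forall i j : 'I_m, (i < j)%N -> (k i < k j)%N)
    (a_gt0 : forall i, (0 < a i)%N) :
  let l := dual_dims n k in
  let b := dual_mults a in
  let Psi_N : section R n k a N -> section R n l b N := Psi_tilde k_bounds in
  (* Psi_N is a linear isomorphism from R_k^(N) onto R_l^(N) *)
  set_bij (@holomorphic_section R n m k a N) (@holomorphic_section R n m l b N)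
    Psi_N /\
  (forall (c : complex R) (s t : section R n k a N),
     holomorphic_section s -> holomorphic_section t ->
     Psi_N (c *: s + t) = c *: Psi_N s + Psi_N t) /\
  (forall s : section R n k a N, standard_vector s -> holomorphic_section s) /\
  (* it is diagonal relative to the standard bases *)
  (forall s : section R n k a N, standard_vector s ->
     exists (c : complex R) (t : section R n l b N),
       standard_vector t /\ Psi_N s = c *: t) /\
  (forall T : filling n k a N, semistandard T ->
     semistandard (dual_filling T) /\
     Psi_N (standard_section T) = epsilon R T *: standard_section (dual_filling T)).
Proof.
have km (i j : 'I_m) : (i <= j)%N -> (k i <= k j)%N.
  by rewrite leq_eqVlt => /orP[/eqP/val_inj->|/k_incr/ltnW].
have kn i : (k i <= n)%N by case/andP: (k_bounds i) => _ /ltnW.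
move=> l b Psi_N; split; last split; last split; last split.
- split=> [s|s t|t [tF tH]].
  + exact: Psi_tilde_holomorphic.
  + by move=> /set_mem[sF _] /set_mem[tF _]; exact: Psi_tilde_inj.
  (* The preimage is found among all fibrewise alternating sections; its holomorphy then follows
     from that of [t]. *)
  have [s sF st] := Psi_tilde_surj k_bounds tF.
  exists s => //; apply: (@holomorphic_Psi_tilde R n m k a N k_bounds k_incr s sF).
  by rewrite st.
- by move=> c s t [sF _] [tF _]; exact: Psi_tilde_linear.
- by move=> s [T _ ->]; exact: tensor_res_holomorphic.
- move=> s [T T_ss ->]; exists (epsilon R T), (standard_section (dual_filling T)).
  split; last exact: Psi_tilde_standard.
  by exists (dual_filling T) => //; exact: dual_filling_semistandard.
move=> T T_ss; split; first exact: dual_filling_semistandard.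
exact: Psi_tilde_standard.
Qed.
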